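(* Let $m\ge 2$ and let $(P_{ij,k})_{i,j,k=1}^m$ be a real cubic matrix with $P_{ij,k}=P_{ji,k}$ for all $i,j,k$. Let $V:\mathbb R^m\to\mathbb R^m$, $V(x)=x'$, be the quadratic operator $$x'_k=\sum_{i,j=1}^m P_{ij,k}\,x_ix_j,\qquad k=1,\dots,m.$$ Consider the conditions (i) $\sum_{k=1}^m P_{ij,k}=1$ for all $i,j=1,\dots,m$; (ii) $0\le P_{ii,k}\le 1$ for all $i,k=1,\dots,m$; (iii) $-\frac{1}{m-1}\sqrt{P_{ii,k}P_{jj,k}}\le P_{ij,k}$ for all $i,j,k=1,\dots,m$; (iii') $-\sqrt{P_{ii,k}P_{jj,k}}\le P_{ij,k}\le 1+\sqrt{(1-P_{ii,k})(1-P_{jj,k})}$ for all $i,j,k=1,\dots,m$. Then: (Sufficiency) if (i), (ii) and (iii) hold, then $V$ preserves the simplex $S^{m-1}$, i.e. $V(S^{m-1})\subset S^{m-1}$; (Necessity) if $V$ preserves the simplex $S^{m-1}$, then (i), (ii) and (iii') hold.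
   Context: $S^{m-1}=\{x=(x_1,\dots,x_m)\in\mathbb R^m:\ x_i\ge 0 \text{ for all } i,\ \sum_{i=1}^m x_i=1\}$ is the standard simplex. The symmetry $P_{ij,k}=P_{ji,k}$ is a standing convention, assumed without loss of generality for quadratic operators. *)

(* Defs.v *)
From mathcomp Require Export all_boot all_order all_algebra.
From mathcomp Require Export classical_sets reals.

Set Implicit Arguments.
Unset Strict Implicit.
Unset Printing Implicit Defensive.

Import GRing.Theory Num.Theory.
Local Open Scope ring_scope.
Local Open Scope classical_set_scope.

(* In dimension m this is the simplex usually written S^{m-1}. *)
Definition simplex (R : realType) (m : nat) : set 'rV[R]_m :=
  [set x | (forall i, 0 <= x 0 i) /\ \sum_(i < m) x 0 i = 1].

(* The cubic matrix (P_{ij,k}) is encoded as P i j k. *)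
Definition quadratic_operator (R : realType) (m : nat)
    (P : 'I_m -> 'I_m -> 'I_m -> R) (x : 'rV[R]_m) : 'rV[R]_m :=
  \row_(k < m) \sum_(i < m) \sum_(j < m) P i j k * x 0 i * x 0 j.

Definition preserves_simplex (R : realType) (m : nat)
    (V : 'rV[R]_m -> 'rV[R]_m) : Prop :=
  V @` @simplex R m `<=` @simplex R m.

(* Main.v *)
Require Import Defs.
From mathcomp Require Import ring lra.
Set Implicit Arguments.
Unset Strict Implicit.
Unset Printing Implicit Defensive.
Import Order.TTheory GRing.Theory Num.Theory.
Local Open Scope ring_scope.
Local Open Scope classical_set_scope.

(* Sufficiency: with [a i = sqrt (P i i k) * x i], condition (iii) and AM-GM
   bound the off-diagonal part of [x'_k] below by
   [- (m - 1)^-1 * \sum_(i != j) (a i ^+ 2 + a j ^+ 2) / 2], which is exactly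
   minus the diagonal part [\sum_i a i ^+ 2].

   Necessity: restrict [V] to the edges of the simplex.  On the edge from [e_i]
   to [e_j] each coordinate is a binary quadratic form [q (u, v)], and both [q]
   and [(u + v) ^+ 2 - q] are nonnegative on the quadrant; the middle
   coefficient of such a form is at least minus the geometric mean of the
   outer two. *)

Lemma sum_quadratic_operator (R : realType) (m : nat)
    (P : 'I_m -> 'I_m -> 'I_m -> R) (x : 'rV[R]_m) :
  (forall i j, \sum_(k < m) P i j k = 1) ->
  \sum_(k < m) quadratic_operator P x 0 k = (\sum_(i < m) x 0 i) ^+ 2.
Proof.
move=> P1; under eq_bigr do rewrite mxE.
rewrite exchange_big expr2 mulr_suml /=; apply: eq_bigr => i _.
rewrite exchange_big mulr_sumr /=; apply: eq_bigr => j _.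
by rewrite -!mulr_suml P1 mul1r.
Qed.

Lemma sqrt_mul_amgm (R : realType) (a b x y : R) : 0 <= a -> 0 <= b ->
  Num.sqrt (a * b) * (x * y) <= (a * x ^+ 2 + b * y ^+ 2) / 2.
Proof.
move=> a0 b0; rewrite sqrtrM //.
have := sqr_ge0 (Num.sqrt a * x - Num.sqrt b * y).
(* The third occurrences of [a] and [b] are those outside the square roots. *)
rewrite -{3}(sqr_sqrtr a0) -{3}(sqr_sqrtr b0); lra.
Qed.

Lemma quadratic_operator_ge0 (R : realType) (m : nat)
    (P : 'I_m -> 'I_m -> 'I_m -> R) (x : 'rV[R]_m) (k : 'I_m) :
  (2 <= m)%N -> (forall i, 0 <= P i i k) ->
  (forall i j,
     - ((m%:R - 1)^-1 * Num.sqrt (P i i k * P j j k)) <= P i j k) ->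
  (forall i, 0 <= x 0 i) -> 0 <= quadratic_operator P x 0 k.
Proof.
move=> m2 Pd Po x0; rewrite mxE.
have m1_gt0 : 0 < m%:R - 1 :> R by rewrite subr_gt0 ltr1n.
set c := (m%:R - 1)^-1 in Po.
have c0 : 0 <= c by rewrite invr_ge0 ltW.
have cm : c * m%:R = 1 + c.
  by rewrite -[m%:R](subrK 1) mulrDr mulVf ?mulr1 // gt_eqF.
pose d i := P i i k * x 0 i ^+ 2.
(* One bound for all pairs: at [i = j] the extra [c * d i] cancels the AM-GM loss, leaving exactly
   the diagonal term. *)
have term_ge i j : (i == j)%:R * ((1 + c) * d i) - c * ((d i + d j) / 2)
    <= P i j k * x 0 i * x 0 j.
  have [<-|_] := eqVneq i j; first by rewrite /d /=; lra.
  have xx0 : 0 <= x 0 i * x 0 j by rewrite mulr_ge0.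
  have := ler_wpM2r xx0 (Po i j).
  have := ler_wpM2l c0 (sqrt_mul_amgm (x 0 i) (x 0 j) (Pd i) (Pd j)).
  rewrite -/(d i) -/(d j) /=; lra.
apply: le_trans (ler_sum _ (fun i _ => ler_sum _ (fun j _ => term_ge i j))).
under eq_bigr => i _.
  rewrite sumrB (bigD1 i) //= eqxx mul1r big1 ?addr0; last first.
    by move=> j; rewrite eq_sym => /negPf ->; rewrite mul0r.
  rewrite -mulr_sumr -mulr_suml big_split /= sumr_const card_ord.
  over.
(* The bounds add up to [(1 + c) * S - c * m%:R * S], which vanishes by [cm]. *)
rewrite sumrB -!mulr_sumr -mulr_suml big_split /= sumr_const card_ord.
rewrite sumrMnl -[_ *+ m]mulr_natr -cm; set S := \sum_(i < m) d i.
lra.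
Qed.

(** Arbitrary weights [f] let this evaluate both sums of the quadratic operator and, with [f = 1],
    the coordinate sum. The case [i = j] is included, so edges may degenerate to vertices. *)
Lemma sum_mul_edge (R : realType) (m : nat) (f : 'I_m -> R) (u v : R)
    (i j : 'I_m) :
  \sum_l f l * (u *: delta_mx 0 i + v *: delta_mx 0 j : 'rV_m) 0 l
  = f i * u + f j * v.
Proof.
have sum_delta a w :
    \sum_l f l * (w *: delta_mx 0 a : 'rV_m) 0 l = f a * w.
  rewrite (bigD1 a) //= !mxE !eqxx mulr1 big1 ?addr0 // => l /negPf la.
  by rewrite !mxE la andbF !mulr0.
under eq_bigr do rewrite mxE mulrDr.
by rewrite big_split /= !sum_delta.
Qed.

Lemma quadratic_operator_edge (R : realType) (m : nat)
    (P : 'I_m -> 'I_m -> 'I_m -> R) (u v : R) (i j k : 'I_m) :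
  (forall i j k, P i j k = P j i k) ->
  quadratic_operator P (u *: delta_mx 0 i + v *: delta_mx 0 j) 0 k =
    P i i k * u ^+ 2 + 2 * P i j k * u * v + P j j k * v ^+ 2.
Proof.
move=> Psym; rewrite mxE.
(* After the inner sum is evaluated, the [a]-th coordinate is factored out on the right, so that
   [sum_mul_edge] applies again to the outer sum. *)
under eq_bigr => a _.
  rewrite sum_mul_edge mulrAC [X in _ + X]mulrAC -mulrDl.
  over.
by rewrite sum_mul_edge (Psym j i); ring.
Qed.

Lemma edge_in_simplex (R : realType) (m : nat) (u v : R) (i j : 'I_m) :
  0 <= u -> 0 <= v -> u + v = 1 ->
  simplex (u *: delta_mx 0 i + v *: delta_mx 0 j : 'rV[R]_m).
Proof.
move=> u0 v0 uv1; split=> [l|].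
  by rewrite !mxE addr_ge0 // mulr_ge0.
have := sum_mul_edge (fun=> 1) u v i j.
by under eq_bigr do rewrite mul1r; rewrite !mul1r uv1.
Qed.

Lemma ge_Nsqrt_of_quadrant_form_ge0 (R : realType) (a b c : R) :
  0 <= a -> 0 <= c ->
  (forall u v, 0 <= u -> 0 <= v -> u + v = 1 ->
     0 <= a * u ^+ 2 + 2 * b * u * v + c * v ^+ 2) ->
  - Num.sqrt (a * c) <= b.
Proof.
move=> a0 c0 q_ge0; rewrite leNgt; apply/negP => b_lt.
have ac0 : 0 <= a * c by rewrite mulr_ge0.
have s0 := sqrtr_ge0 (a * c).
have b0 : b < 0 by lra.
have acb : a * c < b ^+ 2 by rewrite -(sqr_sqrtr ac0); nra.
pose s := a + c - 2 * b.
have s_gt0 : 0 < s by rewrite /s; lra.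
have sN0 : s != 0 by rewrite gt_eqF.
(* At [(u, v) = (c - b, a - b)] the form equals [(a * c - b ^+ 2) * s], where
   [s = u + v]; no case distinction on [a = 0] or [c = 0] is needed. *)
have := q_ge0 ((c - b) / s) ((a - b) / s).
have -> : a * ((c - b) / s) ^+ 2 + 2 * b * ((c - b) / s) * ((a - b) / s)
    + c * ((a - b) / s) ^+ 2 = (a * c - b ^+ 2) / s.
  by rewrite /s; field.
have -> : (c - b) / s + (a - b) / s = 1 by rewrite /s; field.
have cb0 : 0 <= (c - b) / s by rewrite divr_ge0 ?(ltW s_gt0) //; lra.
have ab0 : 0 <= (a - b) / s by rewrite divr_ge0 ?(ltW s_gt0) //; lra.
by move=> /(_ cb0 ab0 erefl); rewrite pmulr_lge0 ?invr_gt0 // subr_ge0 leNgt acb.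
Qed.

Theorem theorem1 (R : realType) (m : nat) (m_ge2 : (2 <= m)%N)
    (P : 'I_m -> 'I_m -> 'I_m -> R)
    (P_sym : forall i j k, P i j k = P j i k) :
  (* sufficiency *)
  ((forall i j, \sum_(k < m) P i j k = 1) ->
   (forall i k, 0 <= P i i k <= 1) ->
   (forall i j k,
      - ((m%:R - 1)^-1 * Num.sqrt (P i i k * P j j k)) <= P i j k) ->
   preserves_simplex (quadratic_operator P))
  /\
  (* necessity *)
  (preserves_simplex (quadratic_operator P) ->
   [/\ (forall i j, \sum_(k < m) P i j k = 1),
       (forall i k, 0 <= P i i k <= 1) &
       (forall i j k,
          - Num.sqrt (P i i k * P j j k) <= P i j k
            <= 1 + Num.sqrt ((1 - P i i k) * (1 - P j j k)))]).
Proof.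
split=> [P1 P01 Plow _ [x [x0 x1] <-]|VS].
  split=> [k|]; last by rewrite sum_quadratic_operator // x1 expr1n.
  by apply: quadratic_operator_ge0 => // i; have /andP[] := P01 i k.
have edge i j u v : 0 <= u -> 0 <= v -> u + v = 1 ->
    (forall k, 0 <= P i i k * u ^+ 2 + 2 * P i j k * u * v + P j j k * v ^+ 2)
    /\ \sum_(k < m) (P i i k * u ^+ 2 + 2 * P i j k * u * v
                      + P j j k * v ^+ 2) = 1.
  move=> u0 v0 uv1.
  have [V0 V1] := VS _ (imageP _ (edge_in_simplex i j u0 v0 uv1)).
  split=> [k|]; first by rewrite -quadratic_operator_edge.
  by rewrite -[RHS]V1; apply: eq_bigr => k _; rewrite quadratic_operator_edge.
have vertex i : (forall k, 0 <= P i i k) /\ \sum_(k < m) P i i k = 1.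
  (* A vertex is the degenerate edge [i = j] with [(u, v) = (1, 0)]. *)
  have [V0 V1] := edge i i 1 0 ler01 (lexx 0) (addr0 1).
  split=> [k|]; first by have := V0 k; lra.
  by rewrite -[RHS]V1; apply: eq_bigr => k _; ring.
have coord_le1 (f : 'I_m -> R) k :
    (forall l, 0 <= f l) -> \sum_(l < m) f l = 1 -> f k <= 1.
  by move=> f0 <-; rewrite (bigD1 k) //= lerDl sumr_ge0.
have P01 i k : 0 <= P i i k <= 1.
  have [P0 P1] := vertex i.
  by rewrite P0 (coord_le1 (fun l => P i i l)).
split=> // [i j|i j k].
  (* At the midpoint the coordinate sum reads [1/4 + s/2 + 1/4 = 1], where [s] is the sum of
     [P i j k] over [k]. *)
  have [] := edge i j (1 / 2) (1 / 2); [lra | lra | lra | move=> _].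
  rewrite !big_split /= -!mulr_suml -mulr_sumr.
  by rewrite (vertex i).2 (vertex j).2; lra.
have /andP[Pi0 Pi1] := P01 i k; have /andP[Pj0 Pj1] := P01 j k.
apply/andP; split.
  apply: ge_Nsqrt_of_quadrant_form_ge0 => // u v u0 v0 uv1.
  exact: (edge i j u v u0 v0 uv1).1.
suff : - Num.sqrt ((1 - P i i k) * (1 - P j j k)) <= 1 - P i j k by lra.
apply: ge_Nsqrt_of_quadrant_form_ge0; [lra | lra | move=> u v u0 v0 uv1].
have [q0 q1] := edge i j u v u0 v0 uv1.
have := coord_le1 _ k q0 q1.
(* Replacing 1 by [(u + v) ^+ 2] turns the bound of the coordinate by 1 into nonnegativity of the
   form with coefficients [1 - P]. *)
have : (u + v) ^+ 2 = 1 by rewrite uv1 expr1n.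
lra.
Qed.
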